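(* Let $X$ be a finite set with $|X|\ge 2$. The free monoid $\mathbb{M}_X$ with basis $X$ is atomic and, therefore, homogeneous.
   Context: For a structure $\mathbb{B}$ and a tuple $\bar b$ of elements of $\mathbb{B}$, the type of $\bar b$ is the set of all formulas $\phi(\bar x)$ (without parameters) in the language of $\mathbb{B}$ with $\mathbb{B}\models\phi(\bar b)$. A complete $n$-type $p$ of $Th(\mathbb{B})$ is isolated if there is a formula $\phi(\bar x)\in p$ such that for all formulas $\psi(\bar x)$, $\psi(\bar x)\in p$ if and only if $Th(\mathbb{B})\models(\phi(\bar x)\Rightarrow\psi(\bar x))$. $\mathbb{B}$ is atomic if every complete type (over $\emptyset$) that is realized in $\mathbb{B}$ is isolated. $\mathbb{B}$ is homogeneous if two finite tuples of elements of $\mathbb{B}$ realize the same type if and only if some automorphism of $\mathbb{B}$ maps one to the other. *)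

(* Defs.v *)
From mathcomp Require Import all_boot.

Set Implicit Arguments.
Unset Strict Implicit.
Unset Printing Implicit Defensive.

Record language := Language {
  fsym : Type;
  farity : fsym -> nat;
  rsym : Type;
  rarity : rsym -> nat }.

Record structure (L : language) := Structure {
  carrier :> Type;
  fint : forall f : fsym L, (farity f).-tuple carrier -> carrier;
  rint : forall r : rsym L, (rarity r).-tuple carrier -> Prop }.

Inductive term (L : language) (n : nat) : Type :=
| Var of 'I_n
| App (f : fsym L) of ('I_(farity f) -> term L n).

(* [formula L n] is the type of first-order formulas with equality whose free
   variables are among x_0, ..., x_(n-1).  Under [All], index 0 is the
   quantified variable and x_i becomes index i.+1.  The connectives and the
   quantifier below are complete for classical logic. *)
Inductive formula (L : language) : nat -> Type :=
| Bot n : formula L n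
| Eq n of term L n & term L n : formula L n
| Rel n (r : rsym L) of ('I_(rarity r) -> term L n) : formula L n
| Imp n of formula L n & formula L n : formula L n
| All n of formula L n.+1 : formula L n.

Definition Not (L : language) (n : nat) (phi : formula L n) : formula L n :=
  Imp phi (Bot L n).

Fixpoint eval (L : language) (M : structure L) (n : nat) (v : n.-tuple M)
    (t : term L n) : M :=
  match t with
  | Var i => tnth v i
  | App f ts => fint [tuple eval v (ts i) | i < farity f]
  end.

Fixpoint holds (L : language) (M : structure L) (n : nat)
    (phi : formula L n) : n.-tuple M -> Prop :=
  match phi in formula _ n return n.-tuple M -> Prop with
  | Bot _ => fun _ => False
  | Eq _ s t => fun v => eval v s = eval v t
  | Rel _ r ts => fun v => rint [tuple eval v (ts i) | i < rarity r]
  | Imp _ phi psi => fun v => holds phi v -> holds psi v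
  | All _ phi => fun v => forall x : M, holds phi [tuple of x :: v]
  end.

Definition theory (L : language) := formula L 0 -> Prop.

Definition Th (L : language) (M : structure L) : theory L :=
  fun phi => holds phi [tuple of [::] : seq M].

Definition models (L : language) (M : structure L) (T : theory L) : Prop :=
  forall phi, T phi -> holds phi [tuple of [::] : seq M].

(* Free variables are read as universally quantified. *)
Definition entails (L : language) (T : theory L) (n : nat)
    (phi : formula L n) : Prop :=
  forall M : structure L, models M T -> forall v : n.-tuple M, holds phi v.

Definition tp (L : language) (M : structure L) (n : nat) (b : n.-tuple M) :
    formula L n -> Prop :=
  fun phi => holds phi b.

Definition realizes (L : language) (M : structure L) (n : nat)
    (b : n.-tuple M) (p : formula L n -> Prop) : Prop :=
  forall phi, p phi -> holds phi b.

Definition complete_type (L : language) (T : theory L) (n : nat)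
    (p : formula L n -> Prop) : Prop :=
  (exists (M : structure L) (b : n.-tuple M), models M T /\ realizes b p)
  /\ (forall phi, p phi \/ p (Not phi)).

Definition isolated (L : language) (T : theory L) (n : nat)
    (p : formula L n -> Prop) : Prop :=
  exists2 phi, p phi & forall psi, p psi <-> entails T (Imp phi psi).

Definition atomic (L : language) (M : structure L) : Prop :=
  forall (n : nat) (p : formula L n -> Prop),
    complete_type (Th M) p -> (exists b : n.-tuple M, realizes b p) ->
    isolated (Th M) p.

Definition automorphism (L : language) (M : structure L) (s : M -> M) : Prop :=
  [/\ bijective s,
      forall (f : fsym L) (a : (farity f).-tuple M),
        s (fint a) = fint [tuple of map s a]
    & forall (r : rsym L) (a : (rarity r).-tuple M),
        rint a <-> rint [tuple of map s a]].

Definition homogeneous (L : language) (M : structure L) : Prop :=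
  forall (n : nat) (a b : n.-tuple M),
    (forall phi, tp a phi <-> tp b phi) <->
    (exists2 s : M -> M, automorphism s & [tuple of map s a] = b).

Inductive monoid_op := MulOp | OneOp.

Definition monoid_arity (f : monoid_op) : nat :=
  match f with MulOp => 2 | OneOp => 0 end.

(* The generators are not named by constants. *)
Definition monoid_language : language :=
  @Language monoid_op monoid_arity void (fun _ => 0).

Definition word_op (X : Type) (f : monoid_op) :
    (monoid_arity f).-tuple (seq X) -> seq X :=
  match f with
  | MulOp => fun w => tnth w ord0 ++ tnth w ord_max
  | OneOp => fun _ => [::]
  end.

Definition free_monoid (X : Type) : structure monoid_language :=
  @Structure monoid_language (seq X) (@word_op X) (fun _ _ => False).

(* Main.v *)
Require Import Defs.
From mathcomp Require Import all_boot perm.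
From Stdlib Require Import Classical.

(** Every word is a term in the generators, and the generators are exactly the
    irreducible elements.  Hence, for a tuple [b] of words, the formula "there
    are [#|X|] distinct irreducible elements of which the free variables are
    the values of the terms that spell [b]" holds of [c] if and only if some
    permutation of [X] maps [b] to [c].  This formula thus defines the
    automorphism orbit of [b], so that it isolates the type of [b]. *)

Set Implicit Arguments.
Unset Strict Implicit.
Unset Printing Implicit Defensive.

Section Connectives.
Variables (L : language) (M : structure L).

Definition And n (phi psi : formula L n) : formula L n :=
  Not (Imp phi (Not psi)).

Definition Conj n (I : finType) (P : pred I) (F : I -> formula L n) :
    formula L n :=
  foldr (fun i => And (F i)) (Not (Bot L n)) (enum P).

(** The innermost quantifier binds index 0, so the witnesses form a tuple placed in front of the
    free variables. *)
Fixpoint Exists k n : formula L (k + n) -> formula L n :=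
  match k with
  | 0 => fun phi => phi
  | k.+1 => fun phi => @Exists k n (Not (All (Not phi)))
  end.

(** The universal closure: [Th M] consists of sentences only, whereas [entails] speaks of open
    formulas. *)
Fixpoint Forall n : formula L n -> formula L 0 :=
  match n with
  | 0 => fun phi => phi
  | n.+1 => fun phi => Forall (All phi)
  end.

Lemma holds_And n (phi psi : formula L n) (v : n.-tuple M) :
  holds (And phi psi) v <-> holds phi v /\ holds psi v.
Proof.
split=> [H | [Hphi Hpsi] H]; last exact: H Hphi Hpsi.
by split; apply: NNPP => nH; apply: H => // Hphi Hpsi; apply: nH.
Qed.

Lemma holds_Conj n (I : finType) (P : pred I) (F : I -> formula L n)
    (v : n.-tuple M) :
  holds (Conj P F) v <-> forall i, P i -> holds (F i) v.
Proof.
suff main (s : seq I) :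
    holds (foldr (fun i => And (F i)) (Not (Bot L n)) s) v <->
    forall i, i \in s -> holds (F i) v.
  split=> [/main H i Pi | H]; first by apply: H; rewrite mem_enum.
  by apply/main => i; rewrite mem_enum; apply: H.
elim: s => [|j s IHs].
  by split=> [_ i | _ []]; rewrite ?in_nil.
rewrite [foldr _ _ _]/=; split=> [/holds_And[Fj /IHs Fs] i | Fjs].
  by rewrite inE => /predU1P[-> | /Fs].
apply/holds_And; split; first by apply: Fjs; rewrite mem_head.
by apply/IHs => i si; apply: Fjs; rewrite inE si orbT.
Qed.

Lemma holds_Exists k n (phi : formula L (k + n)) (v : n.-tuple M) :
  holds (Exists phi) v <-> exists u : k.-tuple M, holds phi [tuple of u ++ v].
Proof.
elim: k phi => [|k IHk] phi.
  have nil_cat (u : 0.-tuple M) : [tuple of u ++ v] = v.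
    by apply: val_inj; rewrite tuple0.
  split=> [H | [u]]; last by rewrite nil_cat.
  by exists [tuple]; rewrite nil_cat.
have cons_cat x (u : k.-tuple M) :
    [tuple of x :: [tuple of u ++ v]] = [tuple of [tuple of x :: u] ++ v].
  exact: val_inj.
split=> [/IHk[u H] | [u]].
  apply: NNPP => nH; apply: H => x Hx; apply: nH.
  by exists [tuple of x :: u]; rewrite -cons_cat.
case/tupleP: u => x u H; apply/IHk; exists u => /(_ x); apply.
by rewrite cons_cat.
Qed.

Lemma holds_Forall n (phi : formula L n) :
  holds (Forall phi) [tuple of [::] : seq M] <->
  forall v : n.-tuple M, holds phi v.
Proof.
elim: n phi => [|n IHn] phi.
  split=> [H v | /(_ [tuple])] //.
  by rewrite (tuple0 v).
split=> [/IHn H v | H]; first by case/tupleP: v => x v; apply: H.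
by apply/IHn => v x; apply: H.
Qed.

End Connectives.

Section Orbits.
Variables (L : language) (M : structure L).

Lemma automorphism_eval s (sM : automorphism s) n (t : term L n)
    (v : n.-tuple M) :
  eval [tuple of map s v] t = s (eval v t).
Proof.
case: sM => _ sf _; elim: t => [i | f ts IHts] /=; first by rewrite tnth_map.
rewrite sf; congr fint; apply: eq_from_tnth => i.
by rewrite tnth_map !tnth_mktuple IHts.
Qed.

Lemma automorphism_holds s (sM : automorphism s) n (phi : formula L n)
    (v : n.-tuple M) :
  holds phi v <-> holds phi [tuple of map s v].
Proof.
have [[s' sK s'K] _ sr] := sM.
elim: phi v => [// | m t u | m r ts | m phi IHphi psi IHpsi | m phi IHphi] v /=.
- rewrite !(automorphism_eval sM); split=> [-> // |].
  exact: (can_inj sK).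
- have -> : [tuple eval [tuple of map s v] (ts i) | i < rarity r] =
            [tuple of map s [tuple eval v (ts i) | i < rarity r]].
    apply: eq_from_tnth => i.
    by rewrite tnth_map !tnth_mktuple (automorphism_eval sM).
  exact: sr.
- by split=> H /(IHphi v)/H/(IHpsi v).
- have map_cons x : [tuple of s x :: [tuple of map s v]] =
                    [tuple of map s [tuple of x :: v]] by exact: val_inj.
  split=> H x.
    (* Surjectivity of [s] is used here: every [x] is the image of [s' x]. *)
    by rewrite -(s'K x) map_cons; apply/(IHphi [tuple of _ :: _]).
  by apply/(IHphi [tuple of _ :: _]); rewrite -map_cons.
Qed.

Definition defines_orbit n (b : n.-tuple M) (phi : formula L n) : Prop :=
  forall c : n.-tuple M, holds phi c <->
    exists2 s : M -> M, automorphism s & [tuple of map s b] = c.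

Lemma automorphism_id : automorphism (@id M).
Proof.
have map_idt m (a : m.-tuple M) : [tuple of map id a] = a.
  by apply: val_inj; rewrite /= map_id.
by split=> [|f a|r a]; rewrite ?map_idt //; exists id.
Qed.

Lemma defines_orbit_self n (b : n.-tuple M) (phi : formula L n) :
  defines_orbit b phi -> holds phi b.
Proof.
move=> /(_ b) [_]; apply; exists id; first exact: automorphism_id.
by apply: val_inj; rewrite /= map_id.
Qed.

(** A realized complete type is the whole type of its realization [b]. Whatever satisfies the
    formula defining the orbit of [b] is an automorphic image of [b], and so satisfies every formula
    true of [b]. *)
Lemma atomic_of_definable_orbits :
  (forall n (b : n.-tuple M), exists phi, defines_orbit b phi) -> atomic M.
Proof.
move=> orb n p [_ p_total] [b bp]; have [phi phiP] := orb n b.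
have p_tp psi : p psi <-> holds psi b.
  split=> [/bp // | Hpsi].
  by case: (p_total psi) => // /bp /(_ Hpsi).
have phi_b := defines_orbit_self phiP.
exists phi => [|psi]; first exact/p_tp.
split=> [/p_tp psi_b N NT v | H].
  (* As a sentence of [Th M], the closed implication passes from [M] to the model [N]. *)
  suff: Th M (Forall (Imp phi psi)).
    by move=> /NT H; move: v; apply/(holds_Forall N).
  by apply/holds_Forall => c /phiP [s sM <-]; apply/(automorphism_holds sM psi b).
by apply/p_tp; apply: H phi_b.
Qed.

Lemma homogeneous_of_definable_orbits :
  (forall n (b : n.-tuple M), exists phi, defines_orbit b phi) ->
  homogeneous M.
Proof.
move=> orb n a b; split=> [ab | [s sM <-] phi]; last exact: automorphism_holds.
have [phi phiP] := orb n a.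
by apply/phiP/ab; apply: defines_orbit_self.
Qed.

End Orbits.

Section FreeMonoid.
Variable X : finType.
Notation M := (free_monoid X).

(** The argument function has empty domain; [widen_ord] provides one for every [n], including 0. *)
Definition OneT n : term monoid_language n :=
  @App monoid_language n OneOp
    (fun i => Var monoid_language (widen_ord (leq0n n) i)).

Definition MulT n (t u : term monoid_language n) : term monoid_language n :=
  @App monoid_language n MulOp (fun i : 'I_2 => if i == ord0 then t else u).

(** Under the two quantifiers [i] is shifted by two, index 0 is the left factor and index 1 the
    right one. *)
Definition Irreducible n (i : 'I_n) : formula monoid_language n :=
  And (Not (Eq (Var _ i) (OneT n)))
    (All (All (Imp
      (Eq (Var _ (lift ord0 (lift ord0 i)))
          (MulT (Var _ ord0) (Var _ (lift ord0 ord0))))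
      (Imp (Not (Eq (Var _ ord0) (OneT _)))
           (Eq (Var _ (lift ord0 ord0)) (OneT _)))))).

Definition word_term n (f : X -> 'I_n) (w : seq X) : term monoid_language n :=
  foldr (fun x => MulT (Var _ (f x))) (OneT n) w.

Lemma eval_MulT n (t u : term monoid_language n) (v : n.-tuple M) :
  eval v (MulT t u) = eval v t ++ eval v u :> seq X.
Proof. by rewrite /= !tnth_mktuple. Qed.

Lemma holds_Irreducible n (i : 'I_n) (v : n.-tuple M) :
  holds (Irreducible i) v <-> exists x : X, tnth v i = [:: x].
Proof.
rewrite holds_And; split=> [[/= ne1 irr] | [x vi]].
  case vi: (tnth v i) ne1 => [|x w] // _; exists x; congr (_ :: _).
  (* Splitting off the first letter of [x :: w] forces the rest [w] to be empty. *)
  have := irr w [:: x]; rewrite !tnthS !tnth_mktuple /= !tnthS !tnth0.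
  by apply; rewrite ?vi.
split=> [|y z] /=; first by rewrite vi.
rewrite !tnth_mktuple /= !tnthS !tnth0 vi.
by case: z => [|a z] //= [_]; case: z => [|? ?] // <-.
Qed.

(** The map [g] is left general to serve twice: as the permutation read off from given witnesses,
    and as the identity for the letters themselves. *)
Lemma eval_word_term n (f : X -> 'I_n) (g : X -> X) (v : n.-tuple M) w :
  (forall x, tnth v (f x) = [:: g x]) -> eval v (word_term f w) = map g w.
Proof.
by move=> vf; elim: w => [|x w IHw] //; rewrite [LHS]eval_MulT /= vf IHw.
Qed.

Lemma perm_automorphism (g : {perm X}) : automorphism (M := M) (map g).
Proof.
split=> [|[] a|[]] //; last by rewrite /= !tnth_map map_cat.
by exists (map (g^-1)%g); apply: mapK; [apply: permK | apply: permKV].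
Qed.

Definition orbit_matrix n (b : n.-tuple (seq X)) :
    formula monoid_language (#|X| + n) :=
  And (Conj predT (fun i => Irreducible (lshift n i)))
  (And (Conj [pred p : 'I_#|X| * 'I_#|X| | p.1 != p.2]
          (fun p => Not (Eq (Var _ (lshift n p.1)) (Var _ (lshift n p.2)))))
       (Conj predT (fun j : 'I_n =>
          Eq (Var _ (rshift #|X| j))
             (word_term (fun x => lshift n (enum_rank x)) (tnth b j))))).

Lemma orbit_matrix_defines n (b : n.-tuple (seq X)) :
  defines_orbit (M := M) b (Exists (orbit_matrix b)).
Proof.
move=> c; rewrite holds_Exists; split=> [[u] | [s sM <-]].
  rewrite !holds_And !holds_Conj => -[irr [dist val]].
  have /fin_all_exists[g gP] (i : 'I_#|X|) : exists x : X, tnth u i = [:: x].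
    by have /holds_Irreducible := irr i isT; rewrite tnth_lshift.
  (* The witnesses are pairwise distinct, so sending each letter to the one its witness spells is
     injective, hence a permutation of the finite set [X]. *)
  have g_inj : injective (fun x => g (enum_rank x)).
    move=> x y gxy; apply: enum_rank_inj; apply/eqP/negPn/negP => xy.
    by apply: (dist (enum_rank x, enum_rank y) xy) => /=;
    rewrite !tnth_lshift !gP gxy.
  exists (map (perm g_inj)); first exact: perm_automorphism.
  apply: eq_from_tnth => j; have /= := val j isT.
  rewrite tnth_rshift tnth_map => ->.
  by rewrite (eval_word_term (g := perm g_inj)) // => x;
    rewrite tnth_lshift gP permE.
(* An arbitrary automorphism [s] carries witnesses for [b] to witnesses for its image, so it
   suffices to treat [b] itself. *)
suff [u Hu] : exists u : #|X|.-tuple M,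
    holds (orbit_matrix b) [tuple of u ++ b].
  exists [tuple of map s u].
  have -> : [tuple of [tuple of map s u] ++ [tuple of map s b]] =
            [tuple of map s [tuple of u ++ b]].
    by apply: val_inj; rewrite /= map_cat.
  exact/(automorphism_holds sM _ [tuple of u ++ b]).
(* The one-letter words, in the order that [enum_rank] refers to in the matrix. *)
exists [tuple [:: enum_val i] | i < #|X|].
rewrite !holds_And !holds_Conj; split=> [i _ | ];
  last split=> [[i k] /= ik | j _ /=].
- by apply/holds_Irreducible; exists (enum_val i); rewrite tnth_lshift tnth_mktuple.
- by rewrite !tnth_lshift !tnth_mktuple => -[/enum_val_inj/eqP]; apply/negP.
- rewrite tnth_rshift (eval_word_term (g := id)) ?map_id // => x.
  by rewrite tnth_lshift tnth_mktuple enum_rankK.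
Qed.

End FreeMonoid.

Theorem theorem6 (X : finType) (hX : 1 < #|X|) :
  atomic (free_monoid X) /\ homogeneous (free_monoid X).
Proof.
have orb n (b : n.-tuple (free_monoid X)) : exists phi, defines_orbit b phi.
  by exists (Exists (orbit_matrix b)); apply: orbit_matrix_defines.
split; first exact: atomic_of_definable_orbits.
exact: homogeneous_of_definable_orbits.
Qed.
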